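(* Let $P$ be a finite graded poset with $\hat0$ and with a generalized CW-labeling (in particular, a CW-labeling) $\lambda$. Then $Q_\lambda(P)$ is a Whitney dual of $P$.
   Context: Whitney numbers: $w_k(P)=\sum_{\rho(x)=k}\mu(\hat0,x)$, $W_k(P)=|\{x:\rho(x)=k\}|$; $P,Q$ are Whitney duals if $|w_k(P)|=W_k(Q)$ and $|w_k(Q)|=W_k(P)$ for all $k\ge0$. C-labelings: a maximal chain is an unrefinable chain from $\hat0$ to a maximal element. A C-labeling assigns to each pair $(\mathbf m,e)$, $\mathbf m$ a maximal chain and $e$ a cover relation of $\mathbf m$, a label $\lambda(\mathbf m,e)$ in a poset $\Lambda$, such that maximal chains coinciding along their bottom $d$ cover relations have equal labels on these (so $\lambda(\mathbf c,x\lessdot y)$ is defined for saturated chains $\mathbf c$ from $\hat0$). A rooted interval $[x,y]_{\mathbf r}$ is an interval with a saturated chain $\mathbf r$ from $\hat0$ to $x$; a maximal chain $\mathbf c$ of $[x,y]$ gets the labels of $\mathbf r\cup\mathbf c$. Increasing = strictly increasing label word (bottom to top); ascent-free = no consecutive labels $a<b$. CR-labeling: every rooted interval has exactly one increasing maximal chain. Rank two switching property: for every maximal chain $\mathbf m:\hat0=m_0\lessdot\cdots\lessdot m_k$ and $i<k$ with $\lambda(\mathbf m,m_{i-1}\lessdot m_i)<\lambda(\mathbf m,m_i\lessdot m_{i+1})$ there is a unique $m_i'\neq m_i$ such that $\mathbf m'=(\mathbf m\setminus\{m_i\})\cup\{m_i'\}$ is a maximal chain with the same labels as $\mathbf m$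 except $\lambda(\mathbf m',m_{i-1}\lessdot m_i')=\lambda(\mathbf m,m_i\lessdot m_{i+1})$ and $\lambda(\mathbf m',m_i'\lessdot m_{i+1})=\lambda(\mathbf m,m_{i-1}\lessdot m_i)$, and $m_i'$ is the same for all maximal chains agreeing with $\mathbf m$ in $m_0,\dots,m_{i+1}$. Write $U_i(\mathbf m)=\mathbf m'$, and $U_i(\mathbf m)=\mathbf m$ if no ascent at rank $i$; by consistency $U_i$ is defined on saturated chains from $\hat0$ and on maximal chains of rooted intervals. In a rooted interval, $\mathbf c_1\sim\mathbf c_2$ means they are connected by quadratic exchanges (forwards or backwards). CW-labeling: CR-labeling with the rank two switching property such that in each rooted interval distinct ascent-free maximal chains have distinct label words. Generalized CW-labeling: CR-labeling with the rank two switching property such that (braid) $U_iU_{i+1}U_i(\mathbf c)=U_{i+1}U_iU_{i+1}(\mathbf c)$ whenever a saturated chain $\mathbf c$ from $\hat0$ has strictly increasing labels at ranks $i,i+1,i+2$, and (cancellative) for $z<x<y$, $\mathbf r$ saturated from $\hat0$ to $z$, $\mathbf c$ maximal in $[z,x]$, $\mathbf c_1,\mathbf c_2$ maximal in $[x,y]$: $\mathbf c\cup\mathbf c_1\sim\mathbf c\cup\mathbf c_2$ in $[z,y]_{\mathbf r}$ implies $\mathbf c_1\sim\mathbf c_2$ in $[x,y]_{\mathbf r\cup\mathbf c}$. $Q_\lambda(P)$: $C(P)$ is the set of saturated chains from $\hat0$ ordered by inclusion; $\mathbf c_1\sim_\lambda\mathbf c_2$ iff they have the same top element $y$ and are $\sim$-equivalent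 in $[\hat0,y]$ (rooted at $\{\hat 0\}$). $Q_\lambda(P)$ is the set of classes ordered by the transitive closure of: $X\le Y$ if some $\mathbf c\in X$, $\mathbf d\in Y$ have $\mathbf c\subseteq\mathbf d$. *)

(* Defs.v *)
From HB Require Import structures.
From mathcomp Require Import all_boot all_order.
From mathcomp Require Import ssralg ssrint.
From mathcomp Require Import boolp.
From Stdlib Require Import Relation_Operators.

Set Implicit Arguments.
Unset Strict Implicit.
Unset Printing Implicit Defensive.

Import Order.TTheory.
Local Open Scope order_scope.

Section GenericPoset.
Variables (T : finType) (A : {pred T}) (le : rel T).

Definition plt (x y : T) : bool := le x y && (x != y).

Definition pcover (x y : T) : bool :=
  [&& x \in A, y \in A, plt x y &
      ~~ [exists z, [&& z \in A, plt x z & plt z y]]].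

Definition is_poset : Prop :=
  [/\ forall x, x \in A -> le x x,
      forall x y, x \in A -> y \in A -> le x y -> le y x -> x = y &
      forall x y z, x \in A -> y \in A -> z \in A -> le x y -> le y z -> le x z].

Definition is_bottom (b : T) : Prop := b \in A /\ forall x, x \in A -> le b x.

Definition is_rank (b : T) (rk : T -> nat) : Prop :=
  rk b = 0%N /\ forall x y, pcover x y -> rk y = (rk x).+1.

(* Moebius function mu(b, y), by the usual recursion
   mu(b,b) = 1, mu(b,y) = - sum_{b <= z < y} mu(b,z);
   the fuel #|T| exceeds the length of every chain. *)
Fixpoint mobius_aux (b : T) (n : nat) (y : T) : int :=
  if n is n'.+1 then
    (if y == b then 1%R
     else (- \sum_(z | [&& z \in A, le b z & plt z y]) mobius_aux b n' z)%R)
  else 0%R.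

Definition mobius (b y : T) : int := mobius_aux b #|T| y.

Definition whitney1 (b : T) (rk : T -> nat) (k : nat) : int :=
  (\sum_(x | [&& x \in A, le b x & rk x == k]) mobius b x)%R.

Definition whitney2 (rk : T -> nat) (k : nat) : nat :=
  #|[pred x | (x \in A) && (rk x == k)]|.

End GenericPoset.

Definition whitney_duals (T1 : finType) (A1 : {pred T1}) (le1 : rel T1)
    (b1 : T1) (rk1 : T1 -> nat)
    (T2 : finType) (A2 : {pred T2}) (le2 : rel T2) (b2 : T2) (rk2 : T2 -> nat)
  : Prop :=
  forall k : nat,
    absz (whitney1 A1 le1 b1 rk1 k) = whitney2 A2 rk2 k /\
    absz (whitney1 A2 le2 b2 rk2 k) = whitney2 A1 rk1 k.

(* A saturated chain from z0 :  z0 < c_1 < ... < c_k  is encoded by    *)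
(* the sequence c = [:: c_1; ...; c_k] (c = [::] is the chain {z0}).   *)
(* A C-labeling is encoded by  lam : seq P -> P -> L  where            *)
(* lam c y is the label  lambda(z0::c, last z0 c <. y).                *)
Section Labelings.
Variables (dP : Order.disp_t) (P : finPOrderType dP) (z0 : P).
Variables (dL : Order.disp_t) (L : porderType dL) (lam : seq P -> P -> L).

Definition covP (x y : P) : bool := pcover predT (fun a b => a <= b) x y.

Definition satc (c : seq P) : bool := path covP z0 c.

Definition maxc (c : seq P) : bool :=
  satc c && ~~ [exists y, covP (last z0 c) y].

Definition ichain (x y : P) (c : seq P) : bool := path covP x c && (last x c == y).

(* labels of the maximal chain c of the rooted interval [last z0 r, _]_r *)
Definition lword (r c : seq P) : seq L :=
  [seq lam (r ++ take j c) (nth z0 c j) | j <- iota 0 (size c)].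

Definition word (c : seq P) : seq L := lword [::] c.

Definition increasing (w : seq L) : bool := sorted (fun a b => a < b) w.
Definition ascent_free (w : seq L) : bool := sorted (fun a b => ~~ (a < b)) w.

(* ascent at rank i: lambda(m_{i-1} <. m_i) < lambda(m_i <. m_{i+1}) *)
Definition ascent (c : seq P) (i : nat) : bool :=
  (0 < i)%N && (if drop i.-1 (word c) is a :: b :: _ then a < b else false).

Definition swapw (i : nat) (w : seq L) : seq L :=
  if drop i.-1 w is a :: b :: t then take i.-1 w ++ b :: a :: t else w.

Definition sw_ok (c : seq P) (i : nat) (y : P) : bool :=
  [&& y != nth z0 c i.-1, maxc (set_nth z0 c i.-1 y) &
      word (set_nth z0 c i.-1 y) == swapw i (word c)].

Definition rank_two_switching : Prop :=
  forall c i, maxc c -> ascent c i ->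
    (exists y, sw_ok c i y /\ forall y', sw_ok c i y' -> y' = y) /\
    (forall c2, maxc c2 -> take i.+1 c2 = take i.+1 c ->
       forall y, sw_ok c i y -> sw_ok c2 i y).

(* U_i as a relation on saturated chains: Urel i c c' means c' = U_i(c) *)
Definition Urel (i : nat) (c c' : seq P) : Prop :=
  if ascent c i then
    exists m y, [/\ maxc m, take (size c) m = c, sw_ok m i y &
                    c' = set_nth z0 c i.-1 y]
  else c' = c.

(* quadratic exchanges inside the rooted interval [last z0 r, _]_r *)
Definition qstep (r : seq P) (c1 c2 : seq P) : Prop :=
  exists i, (size r < i)%N /\ Urel i (r ++ c1) (r ++ c2).

Definition qsim (r : seq P) : seq P -> seq P -> Prop :=
  clos_refl_sym_trans (seq P) (qstep r).

Definition is_CR : Prop :=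
  forall r y, satc r -> last z0 r <= y ->
    exists! c, ichain (last z0 r) y c && increasing (lword r c).

Definition braid_property : Prop :=
  forall c i, satc c -> ascent c i -> ascent c i.+1 ->
    forall c1 c2 c3 d1 d2 d3,
      Urel i c c1 -> Urel i.+1 c1 c2 -> Urel i c2 c3 ->
      Urel i.+1 c d1 -> Urel i d1 d2 -> Urel i.+1 d2 d3 -> c3 = d3.

Definition cancellative : Prop :=
  forall r x y c c1 c2, satc r -> last z0 r < x -> x < y ->
    ichain (last z0 r) x c -> ichain x y c1 -> ichain x y c2 ->
    qsim r (c ++ c1) (c ++ c2) -> qsim (r ++ c) c1 c2.

Definition is_CW : Prop :=
  [/\ is_CR, rank_two_switching &
      forall r y c1 c2, satc r -> ichain (last z0 r) y c1 ->
        ichain (last z0 r) y c2 ->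
        ascent_free (lword r c1) -> ascent_free (lword r c2) ->
        c1 <> c2 -> lword r c1 <> lword r c2].

Definition is_genCW : Prop :=
  [/\ is_CR, rank_two_switching, braid_property & cancellative].

(* chains as subsets of P; Q-elements are classes, i.e. sets of chains *)
Definition chainset (c : seq P) : {set P} := [set x | x \in z0 :: c].

Definition simQ (c d : seq P) : Prop :=
  [/\ satc c, satc d, last z0 c = last z0 d & qsim [::] c d].

Definition qclass (c : seq P) : {set {set P}} :=
  [set S | `[< exists d, simQ c d /\ S = chainset d >]].

Definition isQ : {pred {set {set P}}} :=
  fun X => `[< exists c, satc c /\ X = qclass c >].

Definition Qbase (X Y : {set {set P}}) : bool :=
  [&& X \in isQ, Y \in isQ & [exists S in X, exists S' in Y, S \subset S']].

Definition Qle : rel {set {set P}} := connect Qbase.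

Definition Qbot : {set {set P}} := qclass [::].

End Labelings.

(* Main.v *)
(* Every quadratic exchange removes one ascending pair of letters from the label
   word, and two overlapping exchanges are joined by the braid relation; so by
   Newman's lemma each exchange class contains exactly one ascent-free chain.
   Saturated chains of Q starting at its bottom correspond to saturated chains c
   of P starting at z0, through c |-> [c]; by cancellation the maximal chains of
   [[c], [c ++ t]] in Q form the exchange class of t in the interval rooted at c,
   and exactly one of them is ascent-free. In P, the CR property gives exactly one
   increasing chain in each rooted interval.
   Either uniqueness property determines the Moebius function from the bottom: up
   to the sign (-1)^rank, it counts ascent-free chains in P and increasing chains
   in Q. Indeed, summing over the cuts of a nonempty word into an increasing and an
   ascent-free part with the sign of the cutting point gives 0. Both duality
   equations then count the same chains: one ascent-free chain per element of Q,
   one increasing chain per element of P.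
   For a CW-labeling, the braid relation and cancellation are obtained from label
   words: swapping adjacent ascending letters is confluent and cancellative. *)
Require Import Defs.
From mathcomp Require Import all_boot all_order ssralg ssrint boolp.
From Stdlib Require Import Relation_Operators.
Import Order.TTheory.
Local Open Scope order_scope.
Set Implicit Arguments.
Unset Strict Implicit.
Unset Printing Implicit Defensive.

(** * Rewriting and label words *)

Section Rewriting.
Variables (T : Type) (R : T -> T -> Prop).

Lemma clos_rt_rst x y : clos_refl_trans T R x y -> clos_refl_sym_trans T R x y.
Proof.
elim=> {x y}[x y|x|x y z _ xy _]; [exact: rst_step|exact: rst_refl|exact: rst_trans].
Qed.

Variable m : T -> nat.
Hypothesis R_decr : forall x y, R x y -> (m y < m x)%N.

Lemma normal_form_ex x :
  exists2 y, clos_refl_trans T R x y & forall z, ~ R y z.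
Proof.
elim: (m x).+1 {-2}x (ltnSn (m x)) => // n IH {}x lexn.
have [[z xz]|noR] := pselect (exists z, R x z); last first.
  by exists x => [|z xz]; [exact: rt_refl|apply: noR; exists z].
have [|y zy ny] := IH z; first exact: leq_trans (R_decr xz) _.
by exists y => //; apply: rt_trans zy; apply: rt_step.
Qed.

Hypothesis R_local : forall x y z, R x y -> R x z ->
  exists2 w, clos_refl_trans T R y w & clos_refl_trans T R z w.

(** Induction on [m x]: [R_local] joins the two first steps, and the induction hypothesis, applied
    once below each of the two reducts, joins the rest. *)
Lemma newman x y z : clos_refl_trans T R x y -> clos_refl_trans T R x z ->
  exists2 w, clos_refl_trans T R y w & clos_refl_trans T R z w.
Proof.
have head_step a b : clos_refl_trans T R a b ->
    a = b \/ exists2 c, R a c & clos_refl_trans T R c b.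
  elim=> {a b}[a b ab|a|a b c _ IH1 bc IH2]; first by right; exists b => //; exact: rt_refl.
    by left.
  case: IH1 IH2 => [->|[d ad db]] IH2; first exact: IH2.
  by right; exists d => //; apply: rt_trans bc.
elim: (m x).+1 {-2}x (ltnSn (m x)) y z => // n IH {}x lexn y z xy xz.
have [<-|[y1 xy1 y1y]] := head_step _ _ xy; first by exists z => //; exact: rt_refl.
have [<-|[z1 xz1 z1z]] := head_step _ _ xz; first by exists y => //; exact: rt_refl.
have [w y1w z1w] := R_local xy1 xz1.
have [|u yu wu] := IH y1 _ y w y1y y1w; first exact: leq_trans (R_decr xy1) _.
have z1u : clos_refl_trans T R z1 u by apply: rt_trans wu.
have [|v uv zv] := IH z1 _ u z z1u z1z; first exact: leq_trans (R_decr xz1) _.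
by exists v => //; apply: rt_trans uv.
Qed.

(** Convertible elements have a common reduct, by [newman] at each use of transitivity, and an
    element without steps reduces only to itself. *)
Lemma normal_form_uniq x y : clos_refl_sym_trans T R x y ->
  (forall z, ~ R x z) -> (forall z, ~ R y z) -> x = y.
Proof.
have stuck a b : clos_refl_trans T R a b -> (forall z, ~ R a z) -> b = a.
  elim=> {a b}[a b ab|//|a b c _ IH1 _ IH2] na; first by case: (na b).
  by rewrite (IH2 _) ?(IH1 na).
move=> xy nx ny; suff [w xw yw] : exists2 w, clos_refl_trans T R x w &
    clos_refl_trans T R y w by rewrite -(stuck _ _ xw nx) -(stuck _ _ yw ny).
elim: xy {nx ny} => {x y} [x y xy|x|x y _ [w xw yw]|x y z _ [u xu yu] _ [v yv zv]].
- by exists y; [exact: rt_step|exact: rt_refl].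
- by exists x; exact: rt_refl.
- by exists w.
have [w uw vw] := newman yu yv.
by exists w; [exact: rt_trans uw|exact: rt_trans vw].
Qed.

End Rewriting.

Section Words.
Variables (d : Order.disp_t) (L : porderType d).
Implicit Types (a b : L) (u v w : seq L).

Inductive wstep : seq L -> seq L -> Prop :=
| wstep_head a b w : a < b -> wstep [:: a, b & w] [:: b, a & w]
| wstep_cons a u v : wstep u v -> wstep (a :: u) (a :: v).

Lemma wstep_cat u v w : wstep u v -> wstep (w ++ u) (w ++ v).
Proof. by elim: w => //= a w IH /IH; exact: wstep_cons. Qed.

(** All pairs of positions count, adjacent or not: a swap may keep the number of adjacent ascents,
    as from 1 3 2 to 3 1 2, but always lowers this number. *)
Fixpoint ascents (w : seq L) : nat :=
  if w is a :: w' then (count (fun b => (a < b)%O) w' + ascents w')%N else 0.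

Lemma wstep_ascents u v : wstep u v -> (ascents v < ascents u)%N.
Proof.
(* A letter in front counts the greater letters behind it, so the induction must also carry that the
   two words are permutations of each other. *)
move=> uv; suff [] : perm_eq u v /\ (ascents v < ascents u)%N by [].
elim: uv => {u v}[a b w ab|a u v _ [uv IH]].
  split; first by rewrite -[a :: _ :: _]/([:: a; b] ++ w)
    -[b :: _ :: _]/([:: b; a] ++ w) perm_cat2r (perm_catC [:: a] [:: b]).
  by rewrite /= ab (lt_gtF ab) add0n add1n addSn ltnS !addnA
    [(count _ w + count _ w)%N]addnC.
by rewrite perm_cons uv; split=> //=; rewrite (permP uv) ltn_add2l.
Qed.

Let wstar := clos_refl_trans _ wstep.

Lemma wstar_cons a u v : wstar u v -> wstar (a :: u) (a :: v).
Proof.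
elim=> {u v}[u v uv|u|u v w _ uv _]; last exact: rt_trans.
  by apply: rt_step; apply: wstep_cons.
exact: rt_refl.
Qed.

(** Disjoint swaps commute. Overlapping ones start from letters [a < b < c], and both paths lead to
    [c], [b], [a], the ascent [a < c] coming from transitivity. *)
Lemma wstep_local w u v : wstep w u -> wstep w v -> exists2 t, wstar u t & wstar v t.
Proof.
have hd a b s : a < b -> wstar [:: a, b & s] [:: b, a & s].
  by move=> ab; apply: rt_step; apply: wstep_head.
have hd1 c a b s : a < b -> wstar [:: c, a, b & s] [:: c, b, a & s].
  by move=> ab; apply: wstar_cons; apply: hd.
have st s1 s2 : wstep s1 s2 -> wstar s1 s2 by exact: rt_step.
have headP a b s x : a < b -> wstep [:: a, b & s] x ->
    exists2 t, wstar [:: b, a & s] t & wstar x t.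
  move=> ab sx; inversion sx as [a' b' w' _ E1 E2|a' u' v' H E1 E2]; subst.
    by exists [:: b, a & s]; exact: rt_refl.
  inversion H as [a1 c w1 bc E1 E2|a1 u1 v1 H1 E1 E2]; subst.
    have ac := lt_trans ab bc.
    exists [:: c, b, a & w1].
      exact: rt_trans (hd1 _ _ _ _ ac) (hd _ _ _ bc).
    exact: rt_trans (hd _ _ _ ac) (hd1 _ _ _ _ ab).
  exists [:: b, a & v1]; last exact: hd.
  by apply: st; do 2!apply: wstep_cons.
move=> wu; elim: wu v => {w u}[a b w ab|a w u wu IH] v; first exact: headP.
move=> sv; inversion sv as [a' b w' ab E1 E2|a' u' v' H E1 E2]; subst.
  have [|t t1 t2] := headP a b w' (a :: u) ab; first exact: wstep_cons.
  by exists t.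
by have [t t1 t2] := IH _ H; exists (a :: t); exact: wstar_cons.
Qed.

Lemma ascent_free_nf w : ascent_free w <-> forall v, ~ wstep w v.
Proof.
split.
  move=> afw v wv; move: afw; elim: wv => {w v}[a b w ab|a u v _ IH] /=.
    by rewrite ab.
  by move/path_sorted.
elim: w => [//|a [//|b w] IH] nf /=; apply/andP; split.
  by apply/negP => ab; apply: nf (wstep_head w ab).
by apply: IH => v wv; apply: nf (wstep_cons a wv).
Qed.

Lemma ascent_free_uniq u v : clos_refl_sym_trans _ wstep u v ->
  ascent_free u -> ascent_free v -> u = v.
Proof.
by move=> uv /ascent_free_nf nu /ascent_free_nf nv;
  apply: normal_form_uniq wstep_ascents wstep_local _ _ uv nu nv.
Qed.

(* Deleting the first occurrence of [a] maps a swap of two distinct letters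
   to a swap or to nothing. *)
Lemma wsim_rem a u v : clos_refl_sym_trans _ wstep u v ->
  clos_refl_sym_trans _ wstep (rem a u) (rem a v).
Proof.
have wsim_cons b s t : clos_refl_sym_trans _ wstep s t ->
    clos_refl_sym_trans _ wstep (b :: s) (b :: t).
  elim=> {s t}[s t st|s|s t _|s t w _ st _].
  - by apply: rst_step; exact: wstep_cons.
  - exact: rst_refl.
  - exact: rst_sym.
  - exact: rst_trans.
elim=> {u v}[u v|u|u v _|u v w _ uv _]; last first.
- exact: rst_trans.
- exact: rst_sym.
- exact: rst_refl.
elim=> {u v}[b c w bc|b u v uv IH] /=; last first.
  by case: eqP => _; [exact: rst_step|exact: wsim_cons].
have := lt_eqF bc; case: (b =P a) => [->|_] /=.
  by rewrite eq_sym => ->; exact: rst_refl.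
case: (c =P a) => [->|_] _; first exact: rst_refl.
by apply: rst_step; exact: wstep_head.
Qed.

(** The first letter of [w] heads both words, so deleting its first occurrence strips exactly that
    letter. *)
Lemma wsim_cancel w u v : clos_refl_sym_trans _ wstep (w ++ u) (w ++ v) ->
  clos_refl_sym_trans _ wstep u v.
Proof. by elim: w => //= a w IH /(wsim_rem a) /=; rewrite eqxx. Qed.

End Words.

(** * Moebius functions from signed chains *)

Section AlternatingSum.
Import GRing.Theory.
Local Open Scope ring_scope.
Variables (L : Type) (r r' : rel L).
Hypothesis r'E : forall a b, r' a b = ~~ r a b.

(* The valid cutting points come in adjacent pairs: the end [m] of the initial
   [r]-run and [m - 1]. *)
Lemma alternating_split_sum (w : seq L) : (0 < size w)%N ->
  \sum_(0 <= j < (size w).+1 | sorted r (take j w) && sorted r' (drop j w))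
     (-1) ^+ j = 0 :> int.
Proof.
(* Over the cuts after [a], the signed sum is the indicator that all of [a :: s] is an [r']-run. In
   the whole word these cuts get the opposite sign and cancel the cut in front of [a]. *)
have tailE a s : \sum_(0 <= j < (size s).+1 |
    path r a (take j s) && sorted r' (drop j s)) (-1) ^+ j = (path r' a s)%:R :> int.
  elim: s a => [|b s IH] a; first by rewrite big_mkcond big_nat1.
  rewrite big_mkcond big_nat_recl //= -big_mkcond /=.
  under eq_bigr do rewrite exprS.
  rewrite -big_distrr /= r'E; case: (r a b) => /=.
    by rewrite IH mulN1r; case: (path _ _ _); rewrite ?subrr ?oppr0 ?addr0.
  by rewrite big_pred0 ?mulr0 ?addr0 //; case: (path _ _ _).
case: w => // a s _; rewrite big_mkcond big_nat_recl //= -big_mkcond /=.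
under eq_bigr do rewrite exprS.
by rewrite -big_distrr /= tailE mulN1r; case: (path _ _ _); rewrite ?subrr ?oppr0 ?addr0.
Qed.

End AlternatingSum.

Section SignedChains.
Import GRing.Theory.
Local Open Scope ring_scope.
Variables (T : finType) (A : {pred T}) (le : rel T) (b : T).
Hypotheses (le_poset : is_poset A le) (b_bot : is_bottom A le b).
Variables (E : eqType) (S : seq (seq E)) (top : seq E -> T).
Hypotheses (S_uniq : uniq S) (nil_in : [::] \in S).
Hypothesis (S_prefix : forall c d, c ++ d \in S -> c \in S).
Hypotheses (top_in : forall c, c \in S -> top c \in A) (top_nil : top [::] = b).
Hypothesis top_bot : forall c, c \in S -> top c = b -> c = [::].
Hypothesis top_le : forall c d, c ++ d \in S -> le (top c) (top (c ++ d)).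
Variables (L : Type) (word : seq E -> seq L) (r r' : rel L).
Hypothesis r'E : forall x y, r' x y = ~~ r x y.
Hypothesis size_word : forall c, size (word c) = size c.
Hypothesis word_take : forall c d, word c = take (size c) (word (c ++ d)).
Hypothesis extend : forall c y, c \in S -> y \in A -> le (top c) y ->
  exists! d, [/\ c ++ d \in S, top (c ++ d) = y &
                 sorted r' (drop (size c) (word (c ++ d)))].

(** The setting is abstract so as to serve both posets: for P, [top] is the last element and [r] the
    negation of [<], so ascent-free chains are counted; for Q, [top] is the exchange class and [r]
    is [<], so increasing chains are counted. *)
Let signed (y : T) : int :=
  \sum_(c <- S | (top c == y) && sorted r (word c)) (-1) ^+ size c.

(** This is the Moebius recursion. By [extend], each chain [c] with top below [y] is a prefix of
    exactly one chain [e] ending at [y] whose word is an [r']-run after [c]. Grouping by [e] leaves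
    the alternating sum over the cuts of the word of [e], which is nonempty because [y != b]. *)
Lemma signed_sum0 y : y \in A -> y != b ->
  \sum_(z | [&& z \in A, le b z & le z y]) signed z = 0.
Proof.
move=> yA yb.
have fiber z : signed z = \sum_(c <- S | sorted r (word c))
    if top c == z then (-1) ^+ size c else 0.
  by rewrite -big_mkcondr; apply: eq_bigl => c; rewrite andbC.
under eq_bigr do rewrite fiber.
rewrite exchange_big /=.
have cE c : c \in S -> \sum_(z | [&& z \in A, le b z & le z y])
      (if top c == z then (-1) ^+ size c else 0) =
    \sum_(e <- S | (top e == y) && prefix c e && sorted r' (drop (size c) (word e)))
      ((-1) ^+ size c : int).
  move=> cS; rewrite -big_mkcondr /=.
  have [le_cy|nle_cy] := boolP (le (top c) y).
    rewrite (big_pred1 (top c)) => [|z]; last first.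
      rewrite /= [z == _]eq_sym; case: eqP => [<-|]; rewrite ?andbF // andbT.
      by rewrite top_in // le_cy b_bot.2 ?top_in.
    have [d [[cdS topd incd] uniqd]] := extend cS yA le_cy.
    rewrite -big_filter (_ : filter _ _ = [:: c ++ d]) ?big_seq1 //.
    apply/perm_small_eq => //; apply: uniq_perm => //; first exact: filter_uniq.
    move=> e; rewrite mem_filter inE; apply/idP/eqP => [|->]; last first.
      by rewrite topd eqxx prefix_prefix incd cdS.
    case/andP=> /andP[/andP[/eqP top_e /prefixP[d' def_e]]]; subst e => *.
    by rewrite (uniqd d').
  rewrite big_pred0 => [|z]; last first.
    apply/negP => /andP[/and3P[_ _ le_zy] /eqP top_z].
    by rewrite top_z le_zy in nle_cy.
  rewrite big_seq_cond big_pred0 // => e; apply/negP.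
  case/andP=> eS /andP[/andP[/eqP top_e /prefixP[d def_e]] _].
  by subst e; rewrite -top_e top_le in nle_cy.
rewrite big_seq_cond (eq_bigr _ (fun c cS => cE c (proj1 (andP cS)))) -big_seq_cond.
under eq_bigr do rewrite big_mkcond.
rewrite exchange_big /= big_seq big1 // => e eS.
under eq_bigr => c _ do rewrite -andbA.
case: (eqVneq (top e) y) => [top_e|_] /=; last by rewrite big1.
rewrite -big_mkcondr /=.
have e_gt0 : (0 < size (word e))%N.
  rewrite size_word lt0n size_eq0; apply: contra_neq yb => e0.
  by rewrite -top_e e0.
rewrite -[RHS](alternating_split_sum r'E e_gt0) size_word.
have takeS j : take j e \in S by apply: (@S_prefix _ (drop j e)); rewrite cat_take_drop.
under eq_bigl do rewrite andbCA.
(* The prefixes of [e] all lie in [S] and are reindexed by their lengths. *)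
rewrite -big_filter_cond (@perm_big _ _ _ _ _ [seq take j e | j <- iota 0 (size e).+1]).
  rewrite big_map big_seq_cond [RHS]big_seq_cond /index_iota subn0.
  apply: eq_big => [j|j]; rewrite mem_iota ltnS /=; case: leqP => //= le_je.
    by rewrite (word_take (take j e) (drop j e)) cat_take_drop size_takel.
  by rewrite size_takel.
apply: uniq_perm; first exact: filter_uniq.
  rewrite map_inj_in_uniq ?iota_uniq // => i j; rewrite !mem_iota /= !ltnS => ie je.
  by move/(congr1 size); rewrite !size_takel.
move=> c; rewrite mem_filter; apply/andP/mapP => [[/prefixP[d ->] _]|[j _ ->]].
  exists (size c); last by rewrite take_size_cat.
  by rewrite mem_iota size_cat /= ltnS leq_addr.
by rewrite prefix_take takeS.
Qed.

Lemma mobius_signed y : y \in A ->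
  mobius A le b y = \sum_(c <- S | (top c == y) && sorted r (word c)) (-1) ^+ size c.
Proof.
have [le_refl le_anti le_trans] := le_poset.
pose D y := [pred z | (z \in A) && plt le z y].
(* It is enough that the fuel [n] exceeds the number of elements strictly below [y], which drops at
   each step of the recursion. *)
suff aux n : forall y, y \in A -> (#|D y| < n)%N -> mobius_aux A le b n y = signed y.
  move=> yA; apply: aux => //; apply: (leq_trans (proper_card _) (max_card predT)).
  apply/properP; split; first exact/subsetP.
  by exists y => //; rewrite !inE /plt eqxx /= !andbF.
elim: n => // n IH {}y yA lt_yn /=; case: (eqVneq y b) => [yb|yb].
  (* Only the empty chain ends at [b], and it contributes 1. *)
  rewrite /signed (big_rem [::]) ?nil_in //= top_nil -yb eqxx /=.
  have -> : word [::] = [::] by apply/nilP; rewrite /nilp size_word.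
  rewrite /= expr0 big_seq_cond big_pred0 ?addr0 // => c; apply/negP.
  case/and3P=> cS /eqP top_c _.
  have c0 : c = [::] by apply: top_bot (mem_rem cS) _; rewrite top_c.
  by rewrite c0 mem_rem_uniqF in cS.
have <- : - \sum_(z | [&& z \in A, le b z & plt le z y]) signed z = signed y.
  have := signed_sum0 yA yb.
  rewrite (bigD1 y) /= ?yA ?le_refl ?b_bot.2 // => /eqP; rewrite addr_eq0 => /eqP ->.
  by congr (- _); apply: eq_bigl => z; rewrite /plt !andbA.
congr (- _); apply: eq_bigr => z /and3P[zA _ /andP[le_zy zy]]; apply: IH => //.
rewrite -ltnS; apply: leq_trans lt_yn; rewrite ltnS; apply: proper_card; apply/properP; split.
  apply/subsetP=> t; rewrite !inE => /and3P[tA le_tz tz]; rewrite tA /plt.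
  rewrite (le_trans _ z) //=; apply: contraNneq tz => ty; subst t.
  by rewrite (le_anti z y).
by exists z; rewrite !inE /plt ?zA ?eqxx ?andbF ?le_zy.
Qed.

(** A chain in [S] whose top has rank [k] has length [k], so all signs within one rank agree. *)
Lemma absz_whitney1 (rk : T -> nat) k : (forall c, c \in S -> rk (top c) = size c) ->
  absz (whitney1 A le b rk k) = count (fun c => sorted r (word c) && (size c == k)) S.
Proof.
move=> rk_top; rewrite /whitney1.
have fiber z : [&& z \in A, le b z & rk z == k] -> mobius A le b z =
    \sum_(c <- S | sorted r (word c)) if top c == z then (-1) ^+ size c else 0.
  case/and3P=> zA _ _; rewrite mobius_signed // -big_mkcondr.
  by apply: eq_bigl => c; rewrite andbC.
rewrite (eq_bigr _ fiber) exchange_big /=.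
rewrite (_ : \sum_(_ <- S | _) _ =
   (-1) ^+ k * (count (fun c => sorted r (word c) && (size c == k)) S)%:R).
  by rewrite abszMsign pmulrn intz.
rewrite -sum1_count natr_sum mulr_sumr.
rewrite [RHS]big_mkcondr big_seq_cond [RHS]big_seq_cond.
apply: eq_bigr => c /andP[cS _]; rewrite -rk_top //.
rewrite -big_mkcondr /=; case: eqP => [rk_c|rk_c].
  rewrite (big_pred1 (top c)) ?mulr1 -?rk_c // => z /=.
  rewrite [z == _]eq_sym; case: (top c =P z) => [<-|]; rewrite ?andbF // andbT.
  by rewrite top_in // eqxx b_bot.2 ?top_in.
rewrite big_pred0 // => z; apply/negP => /andP[/and3P[_ _ /eqP rk_z] /eqP top_z].
by rewrite top_z rk_z in rk_c.
Qed.

End SignedChains.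

(** * Quadratic exchanges *)

Section Exchanges.
Variables (dP : Order.disp_t) (P : finPOrderType dP) (z0 : P).
Variables (dL : Order.disp_t) (L : porderType dL) (lam : seq P -> P -> L).
Implicit Types (r s t c d : seq P) (x y z : P).

Local Notation satc := (satc z0).
Local Notation maxc := (maxc z0).

(** Recursive form of [lword]: the root grows along the chain, so words split under concatenation
    without any indices. *)
Fixpoint labels r c : seq L :=
  if c is x :: c' then lam r x :: labels (r ++ [:: x]) c' else [::].

Lemma lwordE r c : lword z0 lam r c = labels r c.
Proof.
elim: c r => //= x c IH r; rewrite /lword /= cats0; congr (_ :: _).
rewrite (iotaDl 1 0) -map_comp -IH /lword; apply: eq_map => j /=.
by rewrite -catA.
Qed.

Lemma wordE c : word z0 lam c = labels [::] c. Proof. exact: lwordE. Qed.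

Lemma labels_cat r c d : labels r (c ++ d) = labels r c ++ labels (r ++ c) d.
Proof. by elim: c r => [|x c IH] r /=; rewrite ?cats0 // IH -catA. Qed.

Lemma size_labels r c : size (labels r c) = size c.
Proof. by elim: c r => //= x c IH r; rewrite IH. Qed.

Lemma satc_catl c d : satc (c ++ d) -> satc c.
Proof. by rewrite /Defs.satc cat_path => /andP[]. Qed.

Lemma satc_cat c d : satc (c ++ d) = satc c && path (@covP _ P) (last z0 c) d.
Proof. exact: cat_path. Qed.

Lemma covP_lt x y : covP x y -> x < y.
Proof. by case/and4P => _ _ /andP[le_xy ne_xy] _; rewrite lt_neqAle ne_xy. Qed.

Lemma path_covP_lt x c : path (@covP _ P) x c -> path <%O x c.
Proof. by apply: sub_path => ? ?; exact: covP_lt. Qed.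

Lemma size_satc c : satc c -> (size c < #|P|)%N.
Proof.
move=> /path_covP_lt sorted_c; have := lt_sorted_uniq (sorted_c : sorted <%O (z0 :: c)).
by move/card_uniqP => /= <-; exact: max_card.
Qed.

(** The switching property speaks of maximal chains; this makes it available on every saturated
    chain. *)
Lemma maxc_extend c : satc c -> exists t, maxc (c ++ t).
Proof.
elim: (#|P| - size c)%N {-2}c (leqnn (#|P| - size c)) => [|n IH] {}c le_c sat_c.
  by move: le_c; rewrite leqn0 subn_eq0 leqNgt size_satc.
have [/existsP[y cov_y]|no_y] := boolP [exists y, covP (last z0 c) y]; last first.
  by exists [::]; rewrite cats0 /Defs.maxc sat_c.
have [||t max_t] := IH (c ++ [:: y]).
- by rewrite size_cat addn1 subnS -subn1 leq_subLR add1n.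
- by rewrite satc_cat sat_c /= cov_y.
by exists (y :: t); rewrite -catA in max_t.
Qed.

Lemma maxc_sat c : maxc c -> satc c. Proof. by case/andP. Qed.

(* [exch s x y x'] says that U_i, for i = size s + 1, replaces x by x' in every
   saturated chain that starts with s, x, y. *)
Record exch s x y x' : Prop := Exch {
  exch_neq : x' != x;
  exch_sat : satc (s ++ [:: x; y]);
  exch_sat' : satc (s ++ [:: x'; y]);
  exch_lt : lam s x < lam (s ++ [:: x]) y;
  exch_labels1 : lam s x' = lam (s ++ [:: x]) y;
  exch_labels2 : lam (s ++ [:: x']) y = lam s x;
  exch_above : forall t z, satc (s ++ x :: y :: t ++ [:: z]) ->
    lam (s ++ x' :: y :: t) z = lam (s ++ x :: y :: t) z }.

Lemma exch_satc s x y x' t : exch s x y x' ->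
  satc (s ++ x :: y :: t) -> satc (s ++ x' :: y :: t).
Proof.
case=> _ _ + _ _ _ _; rewrite !satc_cat /= => /andP[-> /and3P[-> -> _]].
by case/and4P.
Qed.

Lemma exch_labels s x y x' t : exch s x y x' -> satc (s ++ x :: y :: t) ->
  labels (s ++ [:: x'; y]) t = labels (s ++ [:: x; y]) t.
Proof.
move=> exch_s; suff gen t1 : satc (s ++ x :: y :: t1 ++ t) ->
  labels (s ++ x' :: y :: t1) t = labels (s ++ x :: y :: t1) t by exact: (gen [::]).
elim: t t1 => //= z t IH t1 sat_t; congr (_ :: _).
  apply: (exch_above exch_s).
  by apply: (@satc_catl _ t); rewrite -catA /= -catA.
by have := IH (t1 ++ [:: z]); rewrite -!catA /=; exact.
Qed.

Lemma exch_word s x y x' t : exch s x y x' -> satc (s ++ x :: y :: t) ->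
  labels [::] (s ++ x' :: y :: t) =
  labels [::] s ++ [:: lam (s ++ [:: x]) y, lam s x & labels (s ++ [:: x; y]) t].
Proof.
move=> exch_s sat_t; rewrite labels_cat /= (exch_labels1 exch_s) (exch_labels2 exch_s).
by rewrite -!catA /= (exch_labels exch_s sat_t).
Qed.

Lemma exch_maxc s x y x' t : exch s x y x' ->
  maxc (s ++ x :: y :: t) -> maxc (s ++ x' :: y :: t).
Proof.
move=> exch_s; rewrite /Defs.maxc !last_cat => /andP[sat_t ->].
by rewrite (exch_satc exch_s).
Qed.

Lemma ascentE s x y t :
  ascent z0 lam (s ++ x :: y :: t) (size s).+1 = (lam s x < lam (s ++ [:: x]) y).
Proof. by rewrite /ascent wordE labels_cat /= drop_size_cat ?size_labels. Qed.

Lemma ascent_split c i : ascent z0 lam c i ->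
  exists s x y t, c = s ++ x :: y :: t /\ i = (size s).+1.
Proof.
case/andP; case: i => // i _ /=; rewrite wordE => asc.
have lt_ic : (i.+1 < size c)%N.
  rewrite ltnNge; apply/negP => le_ci; move: asc.
  have : (size (drop i (labels [::] c)) <= 1)%N.
    by rewrite size_drop size_labels leq_subLR addn1.
  by case: drop => // a [].
exists (take i c), (nth z0 c i), (nth z0 c i.+1), (drop i.+2 c).
have lt_ic' := ltnW lt_ic.
by rewrite -!drop_nth // cat_take_drop size_takel // ltnW.
Qed.

Lemma set_nth_mid s x t y : set_nth z0 (s ++ x :: t) (size s) y = s ++ y :: t.
Proof. by elim: s => //= a s ->. Qed.

Lemma sw_okE s x y t x' : sw_ok z0 lam (s ++ x :: y :: t) (size s).+1 x' =
  [&& x' != x, maxc (s ++ x' :: y :: t) & labels [::] (s ++ x' :: y :: t) ==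
     labels [::] s ++ [:: lam (s ++ [:: x]) y, lam s x & labels (s ++ [:: x; y]) t]].
Proof.
rewrite /sw_ok /= set_nth_mid nth_cat ltnn subnn /= !wordE; congr [&& _, _ & _ == _].
rewrite [labels _ (s ++ x :: _)]labels_cat /swapw /= drop_size_cat ?size_labels //.
by rewrite take_size_cat ?size_labels // -catA.
Qed.

Lemma exch_sw_ok s x y t x' : exch s x y x' -> maxc (s ++ x :: y :: t) ->
  sw_ok z0 lam (s ++ x :: y :: t) (size s).+1 x'.
Proof.
move=> exch_s max_t; rewrite sw_okE (exch_neq exch_s) (exch_maxc exch_s) //=.
by rewrite (exch_word exch_s) // maxc_sat.
Qed.

Lemma exch_Urel s x y t x' : exch s x y x' -> satc (s ++ x :: y :: t) ->
  Urel z0 lam (size s).+1 (s ++ x :: y :: t) (s ++ x' :: y :: t).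
Proof.
move=> exch_s sat_t; rewrite /Urel ascentE (exch_lt exch_s).
have [u max_u] := maxc_extend sat_t.
exists ((s ++ x :: y :: t) ++ u), x'; split=> //; first exact: take_size_cat.
  by move: max_u; rewrite -!catA /= => max_u; exact: exch_sw_ok.
by rewrite /= set_nth_mid.
Qed.

Hypothesis R2 : rank_two_switching z0 lam.

Lemma sw_ok_uniq m i y y' : maxc m -> ascent z0 lam m i ->
  sw_ok z0 lam m i y -> sw_ok z0 lam m i y' -> y = y'.
Proof.
by move=> max_m asc_m ok_y ok_y'; have [[y1 [_ U]] _] := R2 max_m asc_m;
  rewrite (U _ ok_y) (U _ ok_y').
Qed.

(** The chain is extended to a maximal one, where the switching property gives [x']. Consistency
    makes the same [x'] work for every maximal extension, which fixes the labels above [y] for all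
    continuations at once. *)
Lemma exch_ex s x y : satc (s ++ [:: x; y]) -> lam s x < lam (s ++ [:: x]) y ->
  exists x', exch s x y x'.
Proof.
move=> sat_s lt_s; have [t max_t] := maxc_extend sat_s.
rewrite -catA /= in max_t.
have asc t' : ascent z0 lam (s ++ x :: y :: t') (size s).+1 by rewrite ascentE.
have [[x' [ok_x' _]] consistent] := R2 max_t (asc t).
have ok t' : maxc (s ++ x :: y :: t') ->
    [/\ x' != x, maxc (s ++ x' :: y :: t'), lam s x' = lam (s ++ [:: x]) y,
        lam (s ++ [:: x']) y = lam s x &
        labels (s ++ [:: x'; y]) t' = labels (s ++ [:: x; y]) t'].
  move=> max_t'; have := consistent _ max_t' _ x' ok_x'.
  rewrite -[(size s).+2]addn2 -!cat_rcons -!cats1 -!catA /= !takeD.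
  rewrite !take_size_cat // !drop_size_cat //= !take0 => /(_ erefl).
  rewrite sw_okE => /and3P[-> -> /eqP]; rewrite labels_cat.
  move/(congr1 (drop (size s))); rewrite !drop_size_cat ?size_labels //= -!catA /=.
  by case.
have [ne_x' max_x' l1 l2 _] := ok _ max_t.
exists x'; split=> //.
  by apply: (@satc_catl _ t); rewrite -catA maxc_sat.
(* The continuation by [t'] and [z] is itself extended to a maximal chain; the label of [z] sits at
   position [size t'] of the compared words. *)
move=> t' z /maxc_extend[u]; rewrite -!catA /= -!catA => /ok[_ _ _ _].
rewrite !labels_cat /= => /(congr1 (drop (size t'))).
by rewrite !drop_size_cat ?size_labels // -!catA => -[].
Qed.

Lemma exch_uniq s x y x1 x2 : exch s x y x1 -> exch s x y x2 -> x1 = x2.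
Proof.
move=> e1 e2; have [t] := maxc_extend (exch_sat e1); rewrite -catA /= => max_t.
apply: (sw_ok_uniq max_t _ (exch_sw_ok e1 max_t) (exch_sw_ok e2 max_t)).
by rewrite ascentE (exch_lt e1).
Qed.

(** Unlike [qstep], this leaves out the chains fixed by U_i, so every step lowers [ascents] and
    rewriting terminates. *)
Definition xstep r c c' := exists s x y x' t,
  [/\ c = s ++ x :: y :: t, c' = s ++ x' :: y :: t, satc (r ++ c) & exch (r ++ s) x y x'].

Definition sim r := clos_refl_sym_trans (seq P) (xstep r).

Lemma qstepE r c c' : qstep z0 lam r c c' -> c = c' \/ xstep r c c'.
Proof.
case=> i [lt_ri]; rewrite /Urel; case: ifP => [asc|_ eq_c]; last first.
  by left; have := congr1 (drop (size r)) eq_c; rewrite !drop_size_cat.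
case=> m [x' [max_m take_m ok_x' def_c']]; right.
have [s0 [x [y [t [def_c def_i]]]]] := ascent_split asc.
(* The exchange takes place above [r], since its rank exceeds [size r]. *)
have [s def_s0] : exists s, s0 = r ++ s.
  exists (drop (size r) s0).
  have le_rs : (size r <= size s0)%N by rewrite -ltnS -def_i.
  rewrite -{1}(cat_take_drop (size r) s0); congr (_ ++ _).
  have := congr1 (take (size r)) def_c; rewrite take_size_cat // => eq_r.
  by rewrite [RHS]eq_r takel_cat.
subst s0 i.
have {}def_c : c = s ++ x :: y :: t.
  by move: def_c; rewrite -catA => /(congr1 (drop (size r))); rewrite !drop_size_cat.
have def_m : m = (r ++ s) ++ [:: x, y & t ++ drop (size (r ++ c)) m].
  by rewrite -{1}(cat_take_drop (size (r ++ c)) m) take_m def_c -!catA.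
have sat_c : satc (r ++ c).
  by rewrite -take_m; apply: (@satc_catl _ (drop (size (r ++ c)) m));
    rewrite cat_take_drop maxc_sat.
have [] := @exch_ex (r ++ s) x y.
- by move: sat_c; rewrite def_c catA -[x :: y :: t]/([:: x; y] ++ t) catA => /satc_catl.
- by move: asc; rewrite def_c catA ascentE.
(* The element switched in [m] is the one given by [exch_ex], by uniqueness in the switching
   property. *)
move=> x1 exch_x1; have eq_x : x1 = x'.
  have max_m' := max_m; rewrite def_m in max_m'.
  apply: (@sw_ok_uniq m (size (r ++ s)).+1) => //.
    by rewrite def_m ascentE (exch_lt exch_x1).
  by rewrite def_m; apply: exch_sw_ok.
subst x1; exists s, x, y, x', t; split=> //.
move: def_c'; rewrite def_c catA /= set_nth_mid -catA.
by move/(congr1 (drop (size r))); rewrite !drop_size_cat.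
Qed.

Lemma xstep_qstep r c c' : xstep r c c' -> qstep z0 lam r c c'.
Proof.
case=> s [x [y [x' [t [-> -> sat_c exch_s]]]]].
exists (size (r ++ s)).+1; split; first by rewrite size_cat ltnS leq_addr.
by rewrite !catA in sat_c *; exact: exch_Urel.
Qed.

Lemma qsimE r c c' : qsim z0 lam r c c' <-> sim r c c'.
Proof.
split; elim=> {c c'}[c c' st|c|c c' _|c d e _ H _]; try exact: rst_refl;
  try exact: rst_sym; try exact: rst_trans H.
  by case: (qstepE st) => [->|]; [exact: rst_refl|exact: rst_step].
by apply: rst_step; exact: xstep_qstep.
Qed.

End Exchanges.

(** * Exchange classes of chains *)

Section ExchangeClasses.
Variables (dP : Order.disp_t) (P : finPOrderType dP) (z0 : P).
Variables (dL : Order.disp_t) (L : porderType dL) (lam : seq P -> P -> L).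
Implicit Types (r s t c d : seq P) (x y z : P).

Local Notation satc := (satc z0).
Local Notation exch := (exch z0 lam).
Local Notation xstep := (xstep z0 lam).
Local Notation sim := (sim z0 lam).
Local Notation labels := (labels lam).

Lemma xstep_sat r c c' t : xstep r c c' -> satc (r ++ c ++ t) = satc (r ++ c' ++ t).
Proof.
case=> s [x [y [x' [u [-> -> sat_c exch_s]]]]]; rewrite catA in sat_c.
have sat_c' := exch_satc exch_s sat_c.
by rewrite !(catA r _ t) !(satc_cat _ _ t) !(catA r s) sat_c sat_c' !last_cat.
Qed.

Lemma xstep_catr r c c' t : xstep r c c' -> satc (r ++ c ++ t) ->
  xstep r (c ++ t) (c' ++ t).
Proof.
case=> s [x [y [x' [u [-> -> _ exch_s]]]]] sat_t.
by exists s, x, y, x', (u ++ t); rewrite -!catA in sat_t *.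
Qed.

Lemma xstep_catl r c d d' : xstep (r ++ c) d d' -> xstep r (c ++ d) (c ++ d').
Proof.
case=> s [x [y [x' [u [-> -> sat_d exch_s]]]]].
by exists (c ++ s), x, y, x', u; rewrite -!catA in sat_d exch_s *.
Qed.

Lemma xstep_wstep r c c' : xstep r c c' -> wstep (labels r c) (labels r c').
Proof.
case=> s [x [y [x' [t [-> -> sat_c exch_s]]]]]; rewrite catA in sat_c.
rewrite !labels_cat /=; apply: wstep_cat.
rewrite (exch_labels1 exch_s) (exch_labels2 exch_s) -!catA /= !catA.
by rewrite (exch_labels exch_s sat_c); apply: wstep_head; exact: exch_lt exch_s.
Qed.

Lemma sim_refl r c : sim r c c. Proof. exact: rst_refl. Qed.

Lemma sim_sym r c d : sim r c d -> sim r d c. Proof. exact: rst_sym. Qed.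

Lemma sim_trans r c d e : sim r c d -> sim r d e -> sim r c e.
Proof. exact: rst_trans. Qed.

Lemma sim_sat r c d t : sim r c d -> satc (r ++ c ++ t) = satc (r ++ d ++ t).
Proof. by elim=> // [c1 d1|c1 d1 e1 _ -> _ //]; exact: xstep_sat. Qed.

Lemma sim_size r c d : sim r c d -> size c = size d.
Proof.
elim=> // [c1 d1|c1 d1 e1 _ -> //].
by case=> s [x [y [x' [t [-> -> _ _]]]]]; rewrite !size_cat.
Qed.

Lemma sim_last r c d z : sim r c d -> last z c = last z d.
Proof.
elim=> // [c1 d1|c1 d1 e1 _ -> //].
by case=> s [x [y [x' [t [-> -> _ _]]]]]; rewrite !last_cat.
Qed.

Lemma sim_catr r c d t : sim r c d -> satc (r ++ c ++ t) -> sim r (c ++ t) (d ++ t).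
Proof.
elim=> [c1 d1 st|c1|c1 d1 cd IH|c1 d1 e1 cd IH1 _ IH2] sat_t.
- by apply: rst_step; exact: xstep_catr.
- exact: sim_refl.
- by apply/sim_sym/IH; rewrite (sim_sat t cd).
by apply: sim_trans (IH1 sat_t) (IH2 _); rewrite -(sim_sat t cd).
Qed.

Lemma sim_catl r c d d' : sim (r ++ c) d d' -> sim r (c ++ d) (c ++ d').
Proof.
elim=> [d1 d2|d1|d1 d2 _|d1 d2 d3 _ IH1 _ IH2].
- by move/xstep_catl; exact: rst_step.
- exact: sim_refl.
- exact: sim_sym.
exact: sim_trans IH2.
Qed.

Lemma sim_wsim r c d : sim r c d ->
  clos_refl_sym_trans _ (@wstep _ L) (labels r c) (labels r d).
Proof.
elim=> [c1 d1 /xstep_wstep|c1|c1 d1 _|c1 d1 e1 _ IH1 _ IH2].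
- exact: rst_step.
- exact: rst_refl.
- exact: rst_sym.
exact: rst_trans IH2.
Qed.

Lemma xstep_ascents r c d : xstep r c d -> (ascents (labels r d) < ascents (labels r c))%N.
Proof. by move/xstep_wstep/wstep_ascents. Qed.

Lemma ascent_free_no_xstep r c : ascent_free (labels r c) -> forall d, ~ xstep r c d.
Proof. by move/ascent_free_nf=> nf d /xstep_wstep; exact: nf. Qed.

Hypothesis R2 : rank_two_switching z0 lam.

Lemma no_xstep_ascent_free r c : satc (r ++ c) -> (forall d, ~ xstep r c d) ->
  ascent_free (labels r c).
Proof.
elim: c r => [//|x [//|y t] IH] r sat_c nf; rewrite /ascent_free /=.
apply/andP; split.
  apply/negP => lt_xy; have [|x' exch_x'] := exch_ex R2 _ lt_xy.
    by apply: (@satc_catl _ _ _ _ t); rewrite -catA.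
  by apply: (nf (x' :: y :: t)); exists [::], x, y, x', t; rewrite cats0.
apply: (IH (r ++ [:: x])) => [|d st]; first by rewrite -catA.
by apply: (nf (x :: d)); exact: (@xstep_catl _ [:: x]).
Qed.

Lemma ascent_free_ex r c : satc (r ++ c) ->
  exists2 d, sim r c d & ascent_free (labels r d).
Proof.
move=> sat_c; have [d cd nf] := normal_form_ex (@xstep_ascents r) c.
have {}cd : sim r c d by exact: clos_rt_rst.
exists d => //; apply: no_xstep_ascent_free nf.
by have := sim_sat [::] cd; rewrite !cats0 => <-.
Qed.

(* Both sides of U_i U_{i+1} U_i = U_{i+1} U_i U_{i+1} on the chain s, x, y, q,
   for i = size s + 1. *)
Definition braid_exch := forall s x y q x1 y2 x3 y1 x2 y3, satc (s ++ [:: x; y; q]) ->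
  exch s x y x1 -> exch (s ++ [:: x1]) y q y2 -> exch s x1 y2 x3 ->
  exch (s ++ [:: x]) y q y1 -> exch s x y1 x2 -> exch (s ++ [:: x2]) y1 q y3 ->
  x3 = x2 /\ y2 = y3.

(** Cancellation at root [[::]], the form that classes of Q call for, with empty chains allowed. *)
Definition cancel_exch := forall c c1 c2, satc (c ++ c1) ->
  sim [::] (c ++ c1) (c ++ c2) -> sim c c1 c2.

(** * Confluence of exchanges *)

Section Confluence.
Hypothesis braid : braid_exch.

(** By symmetry the first exchange is the lower one. Their distance decides the case: at the same
    place they coincide by [exch_uniq], at neighbouring places they are joined by the braid
    relation, further apart they commute. *)
Lemma xstep_local r c u v : xstep r c u -> xstep r c v ->
  exists2 w, clos_refl_trans _ (xstep r) u w & clos_refl_trans _ (xstep r) v w.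
Proof.
have rt1 a b : xstep r a b -> clos_refl_trans _ (xstep r) a b by exact: rt_step.
case=> s [x [y [x1 [t [-> -> sat_c exch1]]]]] [s2 [p [q [p1 [t2 [eq_c -> _ exch2]]]]]].
wlog le_s : s x y x1 t s2 p q p1 t2 sat_c exch1 eq_c exch2 / (size s <= size s2)%N.
  move=> IH; case: (leqP (size s) (size s2)) => [|/ltnW] le_s.
    exact: IH exch1 eq_c exch2 le_s.
  have [|w] := IH _ _ _ _ _ s x y x1 t _ exch2 (esym eq_c) exch1 le_s.
    by rewrite -eq_c.
  by exists w.
have [w def_s2] : exists w, s2 = s ++ w.
  exists (drop (size s) s2); rewrite -{1}(cat_take_drop (size s) s2); congr (_ ++ _).
  by have := congr1 (take (size s)) eq_c; rewrite take_size_cat // takel_cat.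
subst s2; move: eq_c; rewrite -catA => /(congr1 (drop (size s))).
rewrite !drop_size_cat //; case: w exch2 {le_s} => [|x0 [|y0 w]] exch2 /=.
- case=> ? ? ?; subst p q t2; rewrite !cats0 in exch2 *.
  by rewrite (exch_uniq R2 exch1 exch2); exists (s ++ [:: p1, y & t]); exact: rt_refl.
(* Three consecutive labels increase, say a < b < d. Each side is completed by two more exchanges to
   the word d, b, a, and [braid] identifies the resulting chains. *)
- case=> ? ? ?; subst x0 p t; rewrite -!catA /= in sat_c exch2 *.
  rewrite catA in exch2.
  have sat_q : satc ((r ++ s) ++ [:: x; y; q]).
    by apply: (@satc_catl _ _ _ _ t2); rewrite -!catA.
  set s' := r ++ s in exch1 exch2 sat_q.
  have sat_x1 := exch_satc exch1 sat_q.
  have a1 : lam (s' ++ [:: x1; y]) q = lam (s' ++ [:: x; y]) q.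
    exact: (exch_above exch1 (t := [::])).
  have lt_ab := exch_lt exch1; have lt_bd := exch_lt exch2; rewrite -catA /= in lt_bd.
  have [||y2 exch3] := @exch_ex _ _ _ _ _ _ R2 (s' ++ [:: x1]) y q.
  + by rewrite -catA.
  + by rewrite (exch_labels2 exch1) -catA /= a1; exact: lt_trans lt_bd.
  have sat_y2 := exch_sat' exch3; rewrite -catA /= in sat_y2.
  have [||x3 exch4] := @exch_ex _ _ _ _ _ _ R2 s' x1 y2.
  + by apply: (@satc_catl _ _ _ _ [:: q]); rewrite -catA.
  + by rewrite (exch_labels1 exch1) (exch_labels1 exch3) -catA /= a1.
  have sat_y1 := exch_sat' exch2; rewrite -catA /= in sat_y1.
  have [||x2 exch5] := @exch_ex _ _ _ _ _ _ R2 s' x p1.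
  + by apply: (@satc_catl _ _ _ _ [:: q]); rewrite -catA.
  + by rewrite (exch_labels1 exch2) -catA /=; exact: lt_trans lt_bd.
  have a2 : lam (s' ++ [:: x2; p1]) q = lam (s' ++ [:: x; p1]) q.
    exact: (exch_above exch5 (t := [::])).
  have l2 := exch_labels2 exch2; rewrite -catA /= in l2.
  have [||y3 exch6] := @exch_ex _ _ _ _ _ _ R2 (s' ++ [:: x2]) p1 q.
  + by rewrite -catA /=; exact: exch_satc exch5 _.
  + by rewrite (exch_labels2 exch5) -catA /= a2 l2.
  have [? ?] := braid sat_q exch1 exch3 exch4 exch2 exch5 exch6; subst x3 y3.
  have step s1 a b a' t1 : exch (r ++ s1) a b a' -> satc (r ++ s1 ++ a :: b :: t1) ->
      clos_refl_trans _ (xstep r) (s1 ++ a :: b :: t1) (s1 ++ a' :: b :: t1).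
    by move=> e sat_t; apply: rt1; exists s1, a, b, a', t1.
  have sat_tail e : satc (s' ++ e ++ [:: q]) -> satc (r ++ s ++ e ++ q :: t2).
    move: sat_c; rewrite !catA -/s' -[_ :: _ :: _ :: _]/([:: x; y] ++ q :: t2) catA.
    rewrite -!cat_rcons !satc_cat !last_rcons -!cats1 !satc_cat.
    by rewrite -/s' => /andP[_ ->] ->.
  exists (s ++ [:: x2, y2, q & t2]).
    apply: rt_trans (step _ _ _ _ (q :: t2) exch4 _); last exact: (sat_tail [:: x1; y2]).
    have := step (s ++ [:: x1]) y q y2 t2; rewrite -!catA /=; apply.
      by rewrite /s' -catA in exch3.
    exact: (sat_tail [:: x1; y]).
  apply: rt_trans (step _ _ _ _ (q :: t2) exch5 _) _; first exact: (sat_tail [:: x; p1]).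
  have := step (s ++ [:: x2]) p1 q y2 t2; rewrite -!catA /=; apply.
    by rewrite /s' -catA in exch6.
  by apply: (sat_tail [:: x2; p1]); exact: exch_satc exch5 _.
(* The lower exchange leaves all labels above [y] unchanged, so the upper one transfers, field by
   field, to the chain through [x1]. *)
case=> ? ? ?; subst x0 y0 t; rewrite -!catA /= in sat_c exch2 *.
have sat1 : satc (r ++ s ++ [:: x1, y & w ++ [:: p, q & t2]]).
  by have := exch_satc (t := w ++ [:: p, q & t2]) exch1; rewrite -!catA; exact.
have sat2 : satc (r ++ s ++ [:: x, y & w ++ [:: p1, q & t2]]).
  by have := exch_satc (t := t2) exch2; rewrite -!catA /=; exact.
have sat3 : satc (r ++ s ++ [:: x1, y & w ++ [:: p1, q & t2]]).
  by have := exch_satc (t := w ++ [:: p1, q & t2]) exch1; rewrite -!catA; exact.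
exists (s ++ [:: x1, y & w ++ [:: p1, q & t2]]); apply: rt1; last first.
  by exists s, x, y, x1, (w ++ [:: p1, q & t2]).
exists (s ++ [:: x1, y & w]), p, q, p1, t2; rewrite -!catA /=; split=> //.
have above t z : satc (r ++ s ++ [:: x, y & t ++ [:: z]]) ->
    lam (r ++ s ++ [:: x1, y & t]) z = lam (r ++ s ++ [:: x, y & t]) z.
  by rewrite !catA => sat_z; rewrite (exch_above exch1).
have pre e f : satc (r ++ s ++ [:: x, y & w ++ e ++ f]) ->
   satc (r ++ s ++ [:: x, y & w ++ e]).
  by move=> sat_f; apply: (@satc_catl _ _ _ _ f); rewrite -!catA /= -!catA.
have pre1 e f : satc (r ++ s ++ [:: x1, y & w ++ e ++ f]) ->
   satc (r ++ s ++ [:: x1, y & w ++ e]).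
  by move=> sat_f; apply: (@satc_catl _ _ _ _ f); rewrite -!catA /= -!catA.
have satp := pre [:: p; q] t2 sat_c; have satp1 := pre [:: p1; q] t2 sat2.
have cE e : r ++ s ++ [:: x, y & w ++ e] = (r ++ s ++ [:: x, y & w]) ++ e.
  by rewrite -!catA /=.
have cE1 e : r ++ s ++ [:: x1, y & w ++ e] = (r ++ s ++ [:: x1, y & w]) ++ e.
  by rewrite -!catA /=.
split; first exact: exch_neq exch2.
- by rewrite -cE1; exact: (pre1 [:: p; q] t2).
- by rewrite -cE1; exact: (pre1 [:: p1; q] t2).
- rewrite -cE1 !above -?catA //=; last exact: (pre [:: p] [:: q]).
  by rewrite cE; exact: exch_lt exch2.
- rewrite -cE1 !above -?catA //=; last exact: (pre [:: p1] [:: q]).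
  by rewrite cE; exact: exch_labels1 exch2.
- rewrite -cE1 !above -?catA //=; last exact: (pre [:: p] [:: q]).
  by rewrite cE; exact: exch_labels2 exch2.
move=> t z; rewrite -!cE1 => sat_z.
have sat_z0 : satc (r ++ s ++ [:: x, y & w ++ [:: p, q & t ++ [:: z]]]).
  have tailE a e : r ++ s ++ [:: a, y & w ++ [:: p, q & e]] =
      (r ++ s ++ [:: a, y & w ++ [:: p; q]]) ++ e by rewrite -!catA /= -catA.
  rewrite tailE satc_cat satp /=; rewrite tailE satc_cat in sat_z.
  by case/andP: sat_z => _; rewrite !last_cat /= !last_cat.
have sat_z1 : satc (r ++ s ++ [:: x, y & w ++ [:: p1, q & t ++ [:: z]]]).
  by rewrite cE in sat_z0; rewrite cE; exact: exch_satc exch2 _.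
have := above (w ++ [:: p, q & t]) z; rewrite -catA /= => ->//.
have := above (w ++ [:: p1, q & t]) z; rewrite -catA /= => ->//.
by rewrite !cE; apply: (exch_above exch2); rewrite -cE.
Qed.

Lemma ascent_free_class_uniq r c d : sim r c d ->
  ascent_free (labels r c) -> ascent_free (labels r d) -> c = d.
Proof.
move=> cd afc afd; apply: (normal_form_uniq (@xstep_ascents r) (@xstep_local r) cd);
  exact: ascent_free_no_xstep.
Qed.

End Confluence.
End ExchangeClasses.

(** * Braid relation and cancellation for both kinds of labelings *)

Section BraidAndCancel.
Variables (dP : Order.disp_t) (P : finPOrderType dP) (z0 : P).
Variables (dL : Order.disp_t) (L : porderType dL) (lam : seq P -> P -> L).
Implicit Types (r s t c d : seq P) (x y z : P).

Local Notation satc := (satc z0).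
Local Notation exch := (exch z0 lam).
Local Notation sim := (sim z0 lam).
Local Notation labels := (labels lam).

Hypothesis R2 : rank_two_switching z0 lam.

Lemma ichain_sat r c x : satc r ->
  ichain (last z0 r) x c = satc (r ++ c) && (last z0 (r ++ c) == x).
Proof. by move=> sat_r; rewrite /ichain satc_cat sat_r last_cat. Qed.

Lemma genCW_braid_exch : braid_property z0 lam -> braid_exch z0 lam.
Proof.
move=> braid s x y q x1 y2 x3 y1 x2 y3 sat_s e1 e2 e3 e4 e5 e6.
have U1 x0 y0 x0' : exch s x0 y0 x0' -> satc (s ++ [:: x0; y0; q]) ->
    Urel z0 lam (size s).+1 (s ++ [:: x0; y0; q]) (s ++ [:: x0'; y0; q]).
  exact: exch_Urel.
have U2 x0 y0 y0' : exch (s ++ [:: x0]) y0 q y0' ->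
    Urel z0 lam (size s).+2 (s ++ [:: x0; y0; q]) (s ++ [:: x0; y0'; q]).
  move=> e; have := exch_Urel e (exch_sat e).
  by rewrite size_cat addn1 -!catA /=.
have sat1 := exch_satc e1 sat_s.
have sat2 := exch_sat' e2; have sat3 := exch_sat' e4; rewrite -!catA /= in sat2 sat3.
have asc1 : ascent z0 lam (s ++ [:: x; y; q]) (size s).+1.
  by rewrite ascentE (exch_lt e1).
have asc2 : ascent z0 lam (s ++ [:: x; y; q]) (size s).+2.
  have := ascentE z0 lam (s ++ [:: x]) y q [::].
  by rewrite size_cat addn1 -!catA /= => ->; have := exch_lt e4; rewrite -catA.
have := braid _ _ sat_s asc1 asc2 _ _ _ _ _ _ (U1 _ _ _ e1 sat_s) (U2 _ _ _ e2)
  (U1 _ _ _ e3 sat2) (U2 _ _ _ e4) (U1 _ _ _ e5 sat3) (U2 _ _ _ e6).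
by move/(congr1 (drop (size s))); rewrite !drop_size_cat // => -[-> ->].
Qed.

Lemma path_covP_last_lt x c : path (@covP _ P) x c -> c != [::] -> x < last x c.
Proof.
case: c => // y c /path_covP_lt; rewrite (path_sortedE lt_trans) => /andP[/allP lt_x _] _.
exact: lt_x (mem_last _ _).
Qed.

Lemma genCW_cancel_exch : cancellative z0 lam -> cancel_exch z0 lam.
Proof.
(* [cancellative] asks for strict inequalities, so an empty [c] or [c1] is treated apart; in the
   latter case equal lengths force [c2] to be empty. *)
move=> cancel c c1 c2 sat1 sim12; have [c0|c_n0] := eqVneq c [::].
  by rewrite c0 in sim12 *.
have eq_last : last z0 (c ++ c1) = last z0 (c ++ c2) by exact: sim_last sim12.
have sat2 : satc (c ++ c2).
  by have := sim_sat [::] sim12; rewrite /= !cats0 => <-.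
have sat_c := satc_catl sat1.
have [c10|c1_n0] := eqVneq c1 [::].
  have := sim_size sim12; rewrite c10 !size_cat addn0 => /eqP.
  rewrite -{1}[size c]addn0 eqn_add2l eq_sym => /nilP ->; exact: sim_refl.
apply/(qsimE R2); apply: (cancel [::] (last z0 c) (last z0 (c ++ c1))) => //.
- exact: path_covP_last_lt.
- rewrite last_cat; apply: path_covP_last_lt => //.
  by move: sat1; rewrite satc_cat => /andP[].
- by rewrite ichain_sat ?sat_c /=.
- by rewrite ichain_sat ?sat1 /=.
- by rewrite ichain_sat ?sat2 // eq_last /=.
by apply/(qsimE R2).
Qed.

Hypothesis CW : forall r y c1 c2, satc r -> ichain (last z0 r) y c1 ->
  ichain (last z0 r) y c2 ->
  ascent_free (lword z0 lam r c1) -> ascent_free (lword z0 lam r c2) ->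
  c1 <> c2 -> lword z0 lam r c1 <> lword z0 lam r c2.

Lemma CW_word_inj r c1 c2 : satc (r ++ c1) -> satc (r ++ c2) ->
  last z0 (r ++ c1) = last z0 (r ++ c2) -> ascent_free (labels r c1) ->
  labels r c1 = labels r c2 -> c1 = c2.
Proof.
move=> sat1 sat2 eq_last af1 eq_w; have sat_r := satc_catl sat1.
have [//|/eqP ne_c] := eqVneq c1 c2; exfalso.
apply: (@CW r (last z0 (r ++ c1)) c1 c2); rewrite ?lwordE -?eq_w // ichain_sat //.
  by rewrite sat1 /=.
by rewrite sat2 eq_last /=.
Qed.

(* Both sides of the braid relation carry the decreasing word of the same
   three labels. *)
Lemma CW_braid_exch : braid_exch z0 lam.
Proof.
move=> s x y q x1 y2 x3 y1 x2 y3 sat_s e1 e2 e3 e4 e5 e6.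
have above u v w v' : exch s u v v' -> satc (s ++ [:: u; v; w]) ->
    lam (s ++ [:: v'; v]) w = lam (s ++ [:: u; v]) w.
  by move=> e sat_w; exact: (exch_above e (t := [::])).
have sat1 := exch_satc e1 sat_s.
have sat2 := exch_sat' e2; have sat3 := exch_sat' e4; rewrite -!catA /= in sat2 sat3.
have sat4 := exch_satc e3 sat2; have sat5 := exch_sat' e6; rewrite -!catA /= in sat5.
have l1 := exch_labels1 e1; have l2 := exch_labels2 e1; have l3 := above _ _ _ _ e1 sat_s.
have m1 := exch_labels1 e2; have m2 := exch_labels2 e2.
have n1 := exch_labels1 e4; have n2 := exch_labels2 e4.
have a3 := above _ _ _ _ e3 sat2; have a5 := above _ _ _ _ e5 sat3.
have k1 := exch_labels1 e6; have k2 := exch_labels2 e6.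
have lt1 := exch_lt e1; have lt2 := exch_lt e4.
rewrite -!catA /= in m1 m2 n1 n2 k1 k2 lt2.
have w1 : labels s [:: x3; y2; q] =
    [:: lam (s ++ [:: x; y]) q; lam (s ++ [:: x]) y; lam s x].
  by rewrite /= -!catA /= (exch_labels1 e3) (exch_labels2 e3) m1 l3 l1 a3 m2 l2.
have w2 : labels s [:: x2; y3; q] =
    [:: lam (s ++ [:: x; y]) q; lam (s ++ [:: x]) y; lam s x].
  by rewrite /= -!catA /= (exch_labels1 e5) n1 k1 k2 a5 n2 (exch_labels2 e5).
suff [-> ->] : [:: x3; y2; q] = [:: x2; y3; q] by [].
apply: (@CW_word_inj s) => //; first by rewrite !last_cat.
  by rewrite w1 /ascent_free /= (lt_gtF lt1) (lt_gtF lt2).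
by rewrite w1 w2.
Qed.

(** Replace [c1] and [c2] by ascent-free chains [d1] and [d2] equivalent to them above [c]. The
    words of [c ++ d1] and [c ++ d2] are connected by swaps; cancelling the word of [c] leaves two
    connected ascent-free words, which are equal, and the CW condition gives [d1 = d2]. *)
Lemma CW_cancel_exch : cancel_exch z0 lam.
Proof.
move=> c c1 c2 sat1 sim12.
have sat2 : satc (c ++ c2).
  by have := sim_sat [::] sim12; rewrite /= !cats0 => <-.
have [d1 sim1 af1] := ascent_free_ex R2 sat1.
have [d2 sim2 af2] := ascent_free_ex R2 sat2.
have simd : sim [::] (c ++ d1) (c ++ d2).
  apply: sim_trans (sim_trans _ sim12) _; last exact: (@sim_catl _ _ _ _ _ _ [::]).
  by apply/sim_sym/(@sim_catl _ _ _ _ _ _ [::]).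
have eq_w : labels c d1 = labels c d2.
  apply: ascent_free_uniq => //; apply: (@wsim_cancel _ _ (labels [::] c)).
  by have := sim_wsim simd; rewrite !labels_cat.
have satd1 : satc (c ++ d1) by have := sim_sat [::] sim1; rewrite !cats0 => <-.
have satd2 : satc (c ++ d2) by have := sim_sat [::] sim2; rewrite !cats0 => <-.
have eq_d : d1 = d2.
  by apply: (@CW_word_inj c) => //; exact: sim_last simd.
by apply: sim_trans sim1 _; rewrite eq_d; exact: sim_sym.
Qed.

End BraidAndCancel.

(** * The poset of exchange classes *)

Section QuotientPoset.
Variables (dP : Order.disp_t) (P : finPOrderType dP) (z0 : P).
Variables (dL : Order.disp_t) (L : porderType dL) (lam : seq P -> P -> L).
Implicit Types (r s t c d : seq P) (x y z : P) (X Y : {set {set P}}).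

Local Notation satc := (satc z0).
Local Notation sim := (sim z0 lam).
Local Notation labels := (labels lam).
Local Notation qclass := (qclass z0 lam).
Local Notation isQ := (isQ z0 lam).
Local Notation Qle := (Qle z0 lam).

Lemma chainset_inj c d : satc c -> satc d -> chainset z0 c = chainset z0 d -> c = d.
Proof.
move=> /path_covP_lt sc /path_covP_lt sd eq_cd.
suff [] : z0 :: c = z0 :: d by [].
apply: (irr_sorted_eq lt_trans (@ltxx _ P)) => // x.
by have := congr1 (fun S : {set P} => x \in S) eq_cd; rewrite !inE.
Qed.

(** Both chains start at [z0] and have no gaps, so they agree element by element as long as the
    smaller one lasts. *)
Lemma chainset_sub c d : satc c -> satc d -> chainset z0 c \subset chainset z0 d ->
  exists t, d = c ++ t.
Proof.
move=> sat_c sat_d /subsetP sub; have {}sub : {subset c <= z0 :: d}.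
  by move=> x xc; have := sub x; rewrite !inE xc orbT; exact.
move: sub sat_c sat_d; rewrite /Defs.satc.
elim: c z0 d => [|a c IH] z d sub; first by exists d.
case/andP => cov_a path_c path_d.
have : a \in z :: d by apply: sub; rewrite mem_head.
rewrite inE eq_sym (lt_eqF (covP_lt cov_a)) /=; case: d path_d sub => // b d.
move=> /andP[cov_b path_d] sub a_in.
have gt_b : all (> b) d.
  by have := path_covP_lt path_d; rewrite (path_sortedE lt_trans) => /andP[].
have gt_a : all (> a) c.
  by have := path_covP_lt path_c; rewrite (path_sortedE lt_trans) => /andP[].
(* If [a] came later in the larger chain, [b] would lie strictly between [z] and [a], against the
   cover relation. *)
have eq_ab : a = b.
  move: a_in; rewrite inE => /orP[/eqP//|/(allP gt_b) lt_ba].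
  case/and4P: cov_a => _ _ _ /negP[]; apply/existsP; exists b => /=.
  move: (covP_lt cov_b) lt_ba; rewrite /plt !lt_neqAle => /andP[-> ->] /andP[-> ->].
  by [].
subst b; have [|t ->] := IH a d _ path_c path_d; last by exists t.
move=> x xc; have := sub x; rewrite !inE xc orbT => /(_ isT) /orP[/eqP eq_x|//].
have := allP gt_a _ xc; rewrite eq_x => /(lt_trans (covP_lt cov_a)).
by rewrite ltxx.
Qed.

Lemma isQP X : reflect (exists2 c, satc c & X = qclass c) (X \in isQ).
Proof.
apply: (iffP (asboolP _)) => [[c [sat_c ->]]|[c sat_c ->]]; exists c => //.
Qed.

Lemma qclass_in c : satc c -> qclass c \in isQ.
Proof. by move=> sat_c; apply/isQP; exists c. Qed.

Hypothesis R2 : rank_two_switching z0 lam.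

Lemma sim_satc c d : sim [::] c d -> satc c = satc d.
Proof. by move/(sim_sat [::]); rewrite /= !cats0. Qed.

Lemma simQE c d : satc c -> simQ z0 lam c d <-> sim [::] c d.
Proof.
move=> sat_c; split=> [[_ _ _ /(qsimE R2)]//|cd].
by split; [|rewrite -(sim_satc cd)|exact: sim_last cd|exact/(qsimE R2)].
Qed.

Lemma qclassP c S : satc c ->
  reflect (exists2 d, sim [::] c d & S = chainset z0 d) (S \in qclass c).
Proof.
move=> sat_c; rewrite inE; apply: (iffP (asboolP _)) => [[d []]|[d cd ->]].
  by move/(simQE _ sat_c) => cd ->; exists d.
by exists d; split=> //; exact/simQE.
Qed.

Lemma qclass_eq c d : satc c -> satc d -> qclass c = qclass d <-> sim [::] c d.
Proof.
move=> sat_c sat_d; split=> [eq_cd|cd].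
  have : chainset z0 c \in qclass d.
    by rewrite -eq_cd; apply/(qclassP _ sat_c); exists c => //; exact: sim_refl.
  case/(qclassP _ sat_d) => e de eq_ce; apply: sim_sym.
  by rewrite (@chainset_inj c e) // -(sim_satc de).
apply/setP => S; apply/(qclassP _ sat_c)/(qclassP _ sat_d) => -[e se ->]; exists e => //.
  exact: sim_trans (sim_sym cd) se.
exact: sim_trans cd se.
Qed.

(** The representative of the lower class may be chosen freely: if [c'] is equivalent to [c] and
    extends by [t], then [c] extends by the same [t] to an equivalent chain. *)
Lemma Qbase_ext c Y : satc c ->
  Qbase z0 lam (qclass c) Y <-> exists2 t, satc (c ++ t) & Y = qclass (c ++ t).
Proof.
move=> sat_c; split.
  case/and3P => _ /isQP[d sat_d ->] /exists_inP[S /(qclassP _ sat_c)[c' cc' ->]].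
  case/exists_inP => S' /(qclassP _ sat_d)[d' dd' ->] sub.
  have sat_c' : satc c' by rewrite -(sim_satc cc').
  have sat_d' : satc d' by rewrite -(sim_satc dd').
  have [t def_d'] := chainset_sub sat_c' sat_d' sub; subst d'.
  have sat_ct : satc (c ++ t) by rewrite (sim_sat (r := [::]) t cc').
  exists t => //; apply/qclass_eq => //; apply: sim_trans dd' _.
  by apply: sim_sym; exact: sim_catr.
case=> t sat_ct ->; rewrite /Qbase !qclass_in //=; apply/exists_inP.
exists (chainset z0 c); first by apply/qclassP => //; exists c => //; exact: sim_refl.
apply/exists_inP; exists (chainset z0 (c ++ t)).
  by apply/qclassP => //; exists (c ++ t) => //; exact: sim_refl.
by apply/subsetP => x; rewrite !inE mem_cat => /orP[->//|->]; rewrite orbT.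
Qed.

(** Successive extensions concatenate, so the base relation is already transitive. *)
Lemma Qle_ext c Y : satc c ->
  Qle (qclass c) Y <-> exists2 t, satc (c ++ t) & Y = qclass (c ++ t).
Proof.
move=> sat_c; split; last by move/(Qbase_ext _ sat_c)/connect1.
case/connectP => p; elim: p c sat_c => [|X p IH] c sat_c /=.
  by move=> _ ->; exists [::]; rewrite cats0.
case/andP => /(Qbase_ext _ sat_c)[t sat_ct ->] path_p def_Y.
have [t' sat_t' ->] := IH _ sat_ct path_p def_Y.
by exists (t ++ t'); rewrite catA.
Qed.

Lemma Q_poset : is_poset isQ Qle.
Proof.
split=> [X _|X Y /isQP[c sat_c ->] _|X Y Z _ _ _]; first exact: connect0.
  (* Antisymmetry follows from lengths: equivalent chains have equal length, so going up and back
     adds nothing. *)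
  case/(Qle_ext _ sat_c) => t sat_ct ->.
  case/(Qle_ext _ sat_ct) => u; rewrite -catA => sat_u eq_c.
  have := sim_size ((qclass_eq sat_c sat_u).1 eq_c).
  move/eqP; rewrite !size_cat -{1}[size c]addn0 eqn_add2l eq_sym addn_eq0.
  by case/andP => /nilP -> _; rewrite cats0.
exact: connect_trans.
Qed.

Lemma Q_bottom : is_bottom isQ Qle (Qbot z0 lam).
Proof.
split; first exact: qclass_in.
by move=> X /isQP[c sat_c ->]; apply/(Qle_ext _ (c := [::])) => //; exists c.
Qed.

(** The common length of the chains in the class: the predecessor discounts [z0], and the value 0 is
    a default for the empty set. *)
Definition Qrank X : nat := if [pick S in X] is Some C then #|C|.-1 else 0%N.

Lemma card_chainset c : satc c -> #|chainset z0 c| = (size c).+1.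
Proof.
move/path_covP_lt => sorted_c; have := lt_sorted_uniq (sorted_c : sorted <%O (z0 :: c)).
by move/card_uniqP => /= <-; apply: eq_card => x; rewrite inE.
Qed.

Lemma Qrank_qclass c : satc c -> Qrank (qclass c) = size c.
Proof.
move=> sat_c; rewrite /Qrank; case: pickP => [S|/(_ (chainset z0 c))].
  case/(qclassP _ sat_c) => d cd ->; rewrite card_chainset -?(sim_satc cd) //.
  by rewrite (sim_size cd).
by case/negP; apply/(qclassP _ sat_c); exists c => //; exact: sim_refl.
Qed.

Lemma Q_rank : is_rank isQ Qle (Qbot z0 lam) Qrank.
Proof.
split; first by rewrite Qrank_qclass.
move=> X Y /and4P[/isQP[c sat_c ->] _ /andP[/(Qle_ext _ sat_c)[t sat_t ->] ne_ct]].
case: t sat_t ne_ct => [|a [|b t]] sat_t ne_ct no_mid.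
- by rewrite cats0 eqxx in ne_ct.
- by rewrite !Qrank_qclass // size_cat addn1.
have sat_a : satc (c ++ [:: a]) by apply: (@satc_catl _ _ _ _ (b :: t)); rewrite -catA.
have ne_size d e : satc d -> satc e -> size d != size e -> qclass d != qclass e.
  by move=> sat_d sat_e; apply: contra_neq => /(qclass_eq sat_d sat_e)/sim_size.
(* An extension by two or more elements is no cover: the class of [c ++ [:: a]] lies strictly
   between, as the lengths show. *)
case/negP: no_mid; apply/existsP; exists (qclass (c ++ [:: a])).
rewrite qclass_in // /plt !ne_size // ?size_cat ?eqn_add2l //; last first.
  by rewrite -{1}[size c]addn0 eqn_add2l.
rewrite !andbT /=; apply/andP; split; first by apply/Qle_ext => //; exists [:: a].
by apply/Qle_ext => //; exists (b :: t); rewrite -catA.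
Qed.

End QuotientPoset.

(** * Counting chains on both sides of the duality *)

Lemma card_count_image (T : finType) (E : eqType) (s : seq E) (f : E -> T)
    (p : pred E) (A : pred T) : uniq s ->
  {in s &, forall c d, p c -> p d -> f c = f d -> c = d} ->
  (forall c, c \in s -> p c -> A (f c)) ->
  (forall y, A y -> exists c, [/\ c \in s, p c & f c = y]) ->
  #|A| = count p s.
Proof.
move=> uniq_s inj_f f_in f_onto; rewrite -size_filter -(size_map f).
have /card_uniqP <- : uniq [seq f c | c <- s & p c].
  rewrite map_inj_in_uniq ?filter_uniq // => c d; rewrite !mem_filter.
  by case/andP=> pc cs /andP[pd ds]; exact: inj_f.
apply: eq_card => y; rewrite unfold_in; apply/idP/mapP => [/f_onto[c [cs pc <-]]|].
  by exists c; rewrite // mem_filter pc.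
by case=> c; rewrite mem_filter => /andP[pc cs] ->; exact: f_in.
Qed.

Section WhitneyDuality.
Variables (dP : Order.disp_t) (P : finPOrderType dP) (z0 : P).
Variables (dL : Order.disp_t) (L : porderType dL) (lam : seq P -> P -> L).
Variable rho : P -> nat.
Implicit Types (c d : seq P) (x y : P).

Local Notation satc := (satc z0).
Local Notation labels := (labels lam).
Local Notation qclass := (qclass z0 lam).
Local Notation isQ := (isQ z0 lam).
Local Notation Qle := (Qle z0 lam).
Local Notation leP := (fun a b : P => a <= b).

(** Saturated chains increase strictly, so their length is below [#|P|] and bounded sequences
    contain them all. *)
Definition satchains : seq (seq P) :=
  [seq c <- map val (enum {: #|P|.-bseq P}) | satc c].

Lemma satchains_uniq : uniq satchains.
Proof. by rewrite filter_uniq // map_inj_uniq ?enum_uniq //; exact: val_inj. Qed.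

Lemma mem_satchains c : (c \in satchains) = satc c.
Proof.
rewrite mem_filter andb_idr // => sat_c.
by apply/mapP; exists (Bseq (ltnW (size_satc sat_c))); rewrite ?mem_enum.
Qed.

Hypothesis z0_le : forall x, z0 <= x.
Hypothesis rho_rank : is_rank predT leP z0 rho.
Hypothesis CR : is_CR z0 lam.
Hypothesis R2 : rank_two_switching z0 lam.
Hypothesis braid : braid_exch z0 lam.
Hypothesis cancel : cancel_exch z0 lam.

Lemma rank_last c : satc c -> rho (last z0 c) = size c.
Proof.
elim/last_ind: c => [|c x IH]; first by rewrite rho_rank.1.
rewrite -cats1 satc_cat last_cat size_cat addn1 /= andbT => /andP[sat_c cov].
by rewrite (rho_rank.2 _ _ cov) IH.
Qed.

Lemma last_le c d : satc (c ++ d) -> last z0 c <= last z0 (c ++ d).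
Proof.
rewrite satc_cat last_cat => /andP[_ path_d].
have [-> //|d_n0] := eqVneq d [::].
exact: ltW (path_covP_last_lt path_d d_n0).
Qed.

Lemma labels_take c d : labels [::] c = take (size c) (labels [::] (c ++ d)).
Proof. by rewrite labels_cat take_size_cat ?size_labels. Qed.

Lemma labels_drop c d : drop (size c) (labels [::] (c ++ d)) = labels c d.
Proof. by rewrite labels_cat drop_size_cat ?size_labels. Qed.

(** The unique extension by an increasing word is the CR property in the interval rooted at [c]. *)
Lemma absz_whitney1P k : absz (whitney1 predT leP z0 rho k) =
  count (fun c => ascent_free (labels [::] c) && (size c == k)) satchains.
Proof.
have le_poset : is_poset predT leP.
  by split=> [|x y _ _ xy yx|x y z _ _ _]; [|apply/le_anti/andP|exact: le_trans].
apply: (@absz_whitney1 _ _ _ _ le_poset _ _ _ (last z0) satchains_uniq _ _ _ _ _ _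
   _ (labels [::]) _ (fun a b => a < b)) => //; rewrite ?mem_satchains //.
- by move=> c d; rewrite !mem_satchains; exact: satc_catl.
- move=> c; rewrite mem_satchains => sat_c last_c; apply/eqP/contraT => c_n0.
  by have := path_covP_last_lt sat_c c_n0; rewrite last_c ltxx.
- by move=> c d; rewrite mem_satchains; exact: last_le.
- by move=> a b; rewrite negbK.
- exact: size_labels.
- exact: labels_take.
- move=> c y; rewrite mem_satchains => sat_c _ le_cy.
  have [d [/andP[/= ich incr] uniq_d]] := CR sat_c le_cy.
  rewrite ichain_sat // in ich; case/andP: ich => sat_d /eqP last_d.
  exists d; split=> [|e [sat_e last_e incr_e]].
    by rewrite mem_satchains sat_d labels_drop -(lwordE z0).
  rewrite mem_satchains in sat_e; apply: uniq_d.
  by rewrite ichain_sat // sat_e last_e eqxx /= lwordE -labels_drop.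
by move=> c; rewrite mem_satchains; exact: rank_last.
Qed.

Lemma absz_whitney1Q k :
  absz (whitney1 isQ Qle (Qbot z0 lam) (@Qrank _ P) k) =
  count (fun c => increasing (labels [::] c) && (size c == k)) satchains.
Proof.
apply: (@absz_whitney1 _ _ _ _ (Q_poset R2) (Q_bottom R2) _ _ qclass satchains_uniq
   _ _ _ _ _ _ _ (labels [::]) _ (fun a b => ~~ (a < b))) => //; rewrite ?mem_satchains //.
- by move=> c d; rewrite !mem_satchains; exact: satc_catl.
- by move=> c; rewrite mem_satchains; exact: qclass_in.
- move=> c; rewrite mem_satchains => sat_c /(qclass_eq R2 sat_c (d := [::]) isT).
  by move/sim_size/size0nil.
- move=> c d; rewrite mem_satchains => sat_d.
  by apply/(Qle_ext R2 _ (satc_catl sat_d)); exists d.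
- exact: size_labels.
- exact: labels_take.
- move=> c Y; rewrite mem_satchains => sat_c _ /(Qle_ext R2 _ sat_c)[t sat_t ->].
  (* Existence of the extension: an ascent-free chain in the exchange class of [t] above [c]. *)
  have [d td af_d] := ascent_free_ex R2 sat_t.
  have ctd : sim z0 lam [::] (c ++ t) (c ++ d) by exact: (@sim_catl _ _ _ _ _ _ [::]).
  have sat_d : satc (c ++ d) by rewrite -(sim_satc ctd).
  exists d; split=> [|e]; rewrite mem_satchains ?labels_drop; first split=> //.
    by apply/(qclass_eq R2) => //; exact: sim_sym.
  case=> sat_e /(qclass_eq R2 sat_e sat_t) sim_e af_e.
  (* Uniqueness: cancelling [c] puts [d] and [e] into one exchange class above [c], which has a
     single ascent-free chain. *)
  apply: (ascent_free_class_uniq R2 braid _ af_d af_e).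
  by apply: cancel => //; apply: sim_sym; exact: sim_trans ctd.
by move=> c; rewrite mem_satchains; exact: Qrank_qclass.
Qed.

(** By the CR property of the intervals from [z0], each element is the end of exactly one increasing
    chain, whose length is its rank. *)
Lemma whitney2P k : whitney2 predT rho k =
  count (fun c => increasing (labels [::] c) && (size c == k)) satchains.
Proof.
apply: (@card_count_image _ _ _ (last z0)); first exact: satchains_uniq.
- move=> c d; rewrite !mem_satchains => sat_c sat_d /andP[inc_c _] /andP[inc_d _] eq_l.
  have [e [_ uniq_e]] := @CR [::] (last z0 c) isT (z0_le _).
  have incr b : satc b -> increasing (labels [::] b) -> last z0 b = last z0 c -> e = b.
    by move=> sat_b inc_b last_b; apply: uniq_e; rewrite ichain_sat // lwordE sat_b last_b eqxx.
  by rewrite -(incr c) // (incr d).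
- by move=> c; rewrite mem_satchains /= => /rank_last -> /andP[_].
move=> y /= rank_y; have [c [/andP[ich inc] _]] := @CR [::] y isT (z0_le _).
rewrite ichain_sat // in ich; case/andP: ich => sat_c /eqP last_c.
exists c; rewrite mem_satchains sat_c -(lwordE z0) inc -rank_last //.
by rewrite (last_c : last z0 c = y).
Qed.

Lemma whitney2Q k : whitney2 isQ (@Qrank _ P) k =
  count (fun c => ascent_free (labels [::] c) && (size c == k)) satchains.
Proof.
apply: (@card_count_image _ _ _ qclass); first exact: satchains_uniq.
- move=> c d; rewrite !mem_satchains => sat_c sat_d /andP[af_c _] /andP[af_d _].
  by move/(qclass_eq R2 sat_c sat_d) => cd; exact: (ascent_free_class_uniq R2 braid cd).
- move=> c; rewrite mem_satchains /= => sat_c /andP[_ size_c].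
  by rewrite qclass_in // Qrank_qclass.
move=> Y /= /andP[/isQP[c sat_c ->]]; rewrite Qrank_qclass // => size_c.
have [d cd af_d] := ascent_free_ex R2 (sat_c : satc ([::] ++ c)).
have sat_d : satc d by rewrite -(sim_satc cd).
exists d; rewrite mem_satchains sat_d af_d -(sim_size cd) size_c; split=> //.
by apply/(qclass_eq R2) => //; exact: sim_sym.
Qed.

End WhitneyDuality.

Theorem theorem3p37 (dP : Order.disp_t) (P : finPOrderType dP) (z0 : P)
    (dL : Order.disp_t) (L : porderType dL) (lam : seq P -> P -> L)
    (rho : P -> nat) :
  (forall x : P, z0 <= x) ->
  is_rank predT (fun a b : P => a <= b) z0 rho ->
  is_genCW z0 lam \/ is_CW z0 lam ->
  [/\ is_poset (isQ z0 lam) (Qle z0 lam),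
      is_bottom (isQ z0 lam) (Qle z0 lam) (Qbot z0 lam) &
      exists rhoQ : {set {set P}} -> nat,
        is_rank (isQ z0 lam) (Qle z0 lam) (Qbot z0 lam) rhoQ /\
        whitney_duals predT (fun a b : P => a <= b) z0 rho
                      (isQ z0 lam) (Qle z0 lam) (Qbot z0 lam) rhoQ].
Proof.
move=> z0_le rho_rank cw.
have [CR R2 braid cancel] : [/\ is_CR z0 lam, rank_two_switching z0 lam,
    braid_exch z0 lam & cancel_exch z0 lam].
  case: cw => [[CR R2 braid cancel]|[CR R2 CW]]; split=> //.
  - exact: genCW_braid_exch.
  - exact: genCW_cancel_exch.
  - exact: CW_braid_exch.
  - exact: CW_cancel_exch.
split; [exact: Q_poset|exact: Q_bottom|exists (@Qrank _ P); split; first exact: Q_rank].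
move=> k; rewrite (absz_whitney1P z0_le rho_rank CR) (absz_whitney1Q R2 braid cancel).
by rewrite (whitney2P z0_le rho_rank CR) (whitney2Q R2 braid).
Qed.
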